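(* Let $\gamma\in\mathbb{R}$ be fixed and suppose that: (1) there exists $\phi_0>0$ such that $\phi(t)\ge\phi_0 t$ for all $t\ge 0$; (2) the set $\Omega_r(\gamma+\varepsilon)$ is bounded for some $r>0$ and $\varepsilon>0$; (3) $f$ is bounded below on $\Omega_r(\gamma+\varepsilon)$, and $g$ is bounded on this set; (4) the gradients $\nabla f(x)$, $\nabla g_i(x)$, $i\in M$, and the Fréchet derivative $DF(x)$ are bounded on $\Omega_r(\gamma+\varepsilon)$; (5) there exists $a>0$ such that for all $x\in\Omega_r(\gamma+\varepsilon)$ one has $Q(x)[\lambda,\mu]\ge a(\|\lambda\|^2+|\mu|^2)$ for all $\lambda\in H$, $\mu\in\mathbb{R}^m$. Then there exists $c_0>0$ such that for all $c\ge c_0$ the sublevel set $S_c(\gamma)$ is bounded.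
   Context: Setting. $X$ and $H$ are real Hilbert spaces, $M=\{1,\dots,m\}$, and $f,g_i\colon X\to\mathbb{R}$ ($i\in M$), $F\colon X\to H$ are continuously Fréchet differentiable; $g=(g_1,\dots,g_m)$. Problem $(\mathcal{P})$: minimise $f(x)$ subject to $F(x)=0$, $g_i(x)\le 0$, $i\in M$. It is assumed that $(\mathcal{P})$ has a globally optimal solution. $|\cdot|$ is the Euclidean norm; $\max\{y,z\}$ of vectors is taken coordinatewise; $\nabla g(x)y\in\mathbb{R}^m$ is the vector with coordinates $\langle\nabla g_i(x),y\rangle$; $DF(x)[\cdot]\colon X\to H$ is the Fréchet derivative, $DF(x)^*$ its adjoint; $\mathrm{diag}(\cdot)$ is the diagonal matrix. The function $\phi\colon[0,+\infty)\to[0,+\infty]$ is convex, non-decreasing, lower semicontinuous, $\phi(t)=0$ iff $t=0$, $\mathrm{dom}\,\phi\ne\{0\}$, and either $\mathrm{dom}\,\phi=[0,+\infty)$ and $\phi(t)\to+\infty$ as $t\to\infty$, or $\mathrm{dom}\,\phi=[0,\alpha)$ for some $\alpha>0$ and $\phi(t)\to+\infty$ as $t\to\alpha$. The function $\psi\colon[0,+\infty)^m\to\mathbb{R}$ is continuously differentiable and concave, $\psi(0)>0$, $0$ is a global maximum point of $\psi$, and $\frac{\partial\psi}{\partial y_i}(y)=0$ whenever $y\in[0,+\infty)^m$, $y_i=0$. Put $b(x)=\psi(\max\{g(x),0\})$, $p(x,\mu)=b(x)/(1+|\mu|^2)$, $\Omega=\{x\in X\mid b(x)>0,\ \phi(\|F(x)\|^2)<+\infty\}$,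 $L(x,\lambda,\mu)=f(x)+\langle\lambda,F(x)\rangle+\langle\mu,g(x)\rangle$ for $\lambda\in H$, $\mu\in\mathbb{R}^m$, and $$\eta(x,\lambda,\mu)=\tfrac12\big\|DF(x)[\nabla_xL(x,\lambda,\mu)]\big\|^2+\tfrac12\sum_{i=1}^m\big(\langle\nabla g_i(x),\nabla_xL(x,\lambda,\mu)\rangle+g_i(x)^2\mu_i\big)^2.$$ For $c>0$ the augmented Lagrangian is $$\mathcal{L}(x,\lambda,\mu,c)=f(x)+\langle\lambda,F(x)\rangle+\tfrac c2(1+\|\lambda\|^2)\phi(\|F(x)\|^2)+\langle\mu,q\rangle+\tfrac{c}{2p(x,\mu)}|q|^2+\eta(x,\lambda,\mu),\quad q=\max\{g(x),-\tfrac1c p(x,\mu)\mu\},$$ if $x\in\Omega$, and $\mathcal{L}(x,\lambda,\mu,c)=+\infty$ otherwise. $S_c(\gamma)=\{(x,\lambda,\mu)\in X\times H\times\mathbb{R}^m\mid\mathcal{L}(x,\lambda,\mu,c)\le\gamma\}$, and $\Omega_c(\gamma)=\{x\in\Omega\mid f(x)+c(\|F(x)\|^2+|\max\{g(x),0\}|^2)\le\gamma\}$. Finally, $$Q(x)[\lambda,\mu]=\tfrac12\Big\|DF(x)\Big[DF(x)^*[\lambda]+\sum_{i=1}^m\mu_i\nabla g_i(x)\Big]\Big\|^2+\tfrac12\Big|\nabla g(x)\Big(DF(x)^*[\lambda]+\sum_{i=1}^m\mu_i\nabla g_i(x)\Big)+\mathrm{diag}(g_i(x)^2)\mu\Big|^2.$$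 *)

(* Defs.v *)
From HB Require Import structures.
From mathcomp Require Import all_boot all_order all_algebra.
From mathcomp Require Import sesquilinear.
From mathcomp Require Import all_classical all_reals all_analysis.

Set Implicit Arguments.
Unset Strict Implicit.
Unset Printing Implicit Defensive.

Import Order.TTheory GRing.Theory Num.Theory.
Import numFieldNormedType.Exports.

Local Open Scope classical_set_scope.
Local Open Scope ring_scope.

(* Real Hilbert spaces: the norm of a complete normed module over R comes from
   an inner product.  A [{dot V for idfun}] is a symmetric, positive definite
   bilinear form on V. *)
HB.mixin Record CompleteNormedModule_isHilbert (R : realType) V
    of CompleteNormedModule R V := {
  hdot : {dot V for (@idfun R)} ;
  hdot_norm : forall x : V, hdot x x = `|x| ^+ 2
}.

#[short(type="hilbertType")]
HB.structure Definition Hilbert (R : realType) :=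
  { V of CompleteNormedModule R V & CompleteNormedModule_isHilbert R V }.

Notation "''[' x , y ]" := (hdot x%R y%R) : ring_scope.

Section Calculus.
Context {R : realType}.

(* ['d f y] tends to ['d f x] in operator norm. *)
Definition C1 {V W : normedModType R} (f : V -> W) : Prop :=
  (forall x, differentiable f x) /\
  (forall x e, 0 < e ->
     \forall y \near x, forall h, `|'d f y h - 'd f x h| <= e * `|h|).

(* The Riesz representative of ['d f x]. *)
Definition grad {X : hilbertType R} (f : X -> R^o) (x : X) : X :=
  get [set v : X | forall h, '[v, h] = 'd f x h].

Definition adjoint {X H : hilbertType R} (A : X -> H) (l : H) : X :=
  get [set v : X | forall h, '[v, h] = '[l, A h]].

Definition op_bounded_on {V W : normedModType R} (D : set V)
    (A : V -> V -> W) : Prop :=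
  exists K : R, forall x, D x -> forall h, `|A x h| <= K * `|h|.

End Calculus.

Section Euclidean.
Context {R : realType} {m : nat}.
Implicit Types (y z v : 'rV[R]_m) (D : set 'rV[R]_m) (psi : 'rV[R]_m -> R).

(* The library norm on ['rV[R]_m] is the sup norm, hence the separate [enorm]. *)
Definition edot y z : R := \sum_i y 0 i * z 0 i.
Definition enorm y : R := Num.sqrt (edot y y).

Definition vmax y z : 'rV[R]_m := \row_i Num.max (y 0 i) (z 0 i).

Definition orthant : set 'rV[R]_m := [set y | forall i, 0 <= y 0 i].

(* Derivatives relative to D: at a boundary point of the orthant they are
   one-sided, and they do not depend on the values of psi outside D. *)
Definition is_grad_on D psi y v : Prop :=
  forall e, 0 < e -> \forall z \near y, D z ->
    `|psi z - psi y - edot v (z - y)| <= e * enorm (z - y).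

Definition grad_on D psi y : 'rV[R]_m := get (is_grad_on D psi y).

Definition partial_on D psi (i : 'I_m) y : R := grad_on D psi y 0 i.

Definition C1_on D psi : Prop :=
  (forall y, D y -> is_grad_on D psi y (grad_on D psi y)) /\
  {within D, continuous (grad_on D psi)}.

(* The function psi has domain [orthant]; its values elsewhere are irrelevant. *)
Record psi_admissible psi : Prop := {
  psi_C1 : C1_on orthant psi ;
  psi_concave :
    convex_function (orthant : set (convex_lmodType 'rV[R]_m))
                    (fun y => - psi y) ;
  psi0_gt0 : 0 < psi 0 ;
  psi0_max : forall y, orthant y -> psi y <= psi 0 ;
  psi_partial0 : forall y i, orthant y -> y 0 i = 0 ->
    partial_on orthant psi i y = 0
}.

End Euclidean.

Section Phi.
Context {R : realType}.
Local Open Scope ereal_scope.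

Definition halfline : set R := [set t | (0 <= t)%R].

Definition edom (phi : R -> \bar R) : set R :=
  [set t | halfline t /\ phi t < +oo].

(* The function phi has domain [halfline]; its values elsewhere are irrelevant.
   In [phi_convex] the library convention 0 * +oo = 0 is in force. *)
Record phi_admissible (phi : R -> \bar R) : Prop := {
  phi_ge0 : forall t, halfline t -> 0 <= phi t ;
  phi_convex : forall s t a : R, halfline s -> halfline t ->
    (0 <= a <= 1)%R ->
    phi (a * s + (1 - a) * t)%R <= a%:E * phi s + (1 - a)%:E * phi t ;
  phi_nondecreasing : forall s t : R, halfline s -> (s <= t)%R ->
    phi s <= phi t ;
  phi_lsc : lower_semicontinuous (phi : subspace halfline -> \bar R) ;
  phi_eq0 : forall t, halfline t -> (phi t = 0 <-> t = 0%R) ;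
  phi_dom_neq0 : edom phi <> [set 0%R] ;
  phi_dom :
    (edom phi = halfline /\ phi t @[t --> +oo%R] --> +oo) \/
    (exists alpha : R, [/\ (0 < alpha)%R,
       edom phi = [set t | (0 <= t < alpha)%R] &
       phi t @[t --> alpha^'-] --> +oo])
}.

End Phi.

Section AugmentedLagrangian.
Context {R : realType} {X H : hilbertType R} {m : nat}.
Variables (f : X -> R^o) (F : X -> H) (g : 'I_m -> X -> R^o).
Variables (phi : R -> \bar R) (psi : 'rV[R]_m -> R).
Implicit Types (x : X) (lambda : H) (mu : 'rV[R]_m) (c gamma : R).

Definition gvec x : 'rV[R]_m := \row_i g i x.

Definition feasible x : Prop := F x = 0 /\ forall i, g i x <= 0.

Definition globally_optimal x : Prop :=
  feasible x /\ forall y, feasible y -> f x <= f y.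

Definition bfun x : R := psi (vmax (gvec x) 0).

Definition pfun x mu : R := bfun x / (1 + enorm mu ^+ 2).

Definition Omega : set X :=
  [set x | 0 < bfun x /\ (phi (`|F x| ^+ 2) < +oo)%E].

Definition lagrangian x lambda mu : R^o :=
  f x + '[lambda, F x] + edot mu (gvec x).

Definition grad_lagrangian x lambda mu : X :=
  grad (fun y => lagrangian y lambda mu) x.

Definition eta x lambda mu : R :=
  2^-1 * `|'d F x (grad_lagrangian x lambda mu)| ^+ 2 +
  2^-1 * \sum_i ('[grad (g i) x, grad_lagrangian x lambda mu]
                 + g i x ^+ 2 * mu 0 i) ^+ 2.

Definition aug_q x mu c : 'rV[R]_m := vmax (gvec x) (- ((c^-1 * pfun x mu) *: mu)).

Definition aug_lagrangian x lambda mu c : \bar R :=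
  if x \in Omega then
    ((f x + '[lambda, F x])%:E
     + (c / 2 * (1 + `|lambda| ^+ 2))%:E * phi (`|F x| ^+ 2)
     + (edot mu (aug_q x mu c) + c / (2 * pfun x mu) * enorm (aug_q x mu c) ^+ 2
        + eta x lambda mu)%:E)%E
  else +oo%E.

Definition sublevel c gamma : set (X * H * 'rV[R]_m) :=
  [set u | (aug_lagrangian u.1.1 u.1.2 u.2 c <= gamma%:E)%E].

Definition Omega_sub c gamma : set X :=
  [set x | Omega x /\
     f x + c * (`|F x| ^+ 2 + enorm (vmax (gvec x) 0) ^+ 2) <= gamma].

Definition grad_g_mul x (y : X) : 'rV[R]_m := \row_i '[grad (g i) x, y].

Definition Qform x lambda mu : R :=
  let w := adjoint ('d F x) lambda + \sum_i mu 0 i *: grad (g i) x in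
  2^-1 * `|'d F x w| ^+ 2 +
  2^-1 * enorm (grad_g_mul x w + mu *m diag_mx (\row_i g i x ^+ 2)) ^+ 2.

End AugmentedLagrangian.

(* Main.v *)
(* Completing squares bounds the multiplier and penalty terms of the augmented
   Lagrangian from below: for [x] in the sublevel set,
     f x + c * phi0 / 2 * |F x|^2 + c / (4 * psi 0) * |max (g x) 0|^2 + eta
       <= gamma + O(1 / c).
   For large [c] this puts [x] in [Omega_r (gamma + eps)], which bounds [x] and,
   since [f] is bounded below there, also [eta].  Now [grad_x L = grad f + w],
   where [w] is the vector of which [Q] is the quadratic form, so [Q] is at most
   [2 * eta] plus a constant, and coercivity of [Q] bounds the multipliers. *)

Require Import Defs.
From HB Require Import structures.
From mathcomp Require Import all_boot all_order all_algebra.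
From mathcomp Require Import sesquilinear ring lra.
From mathcomp Require Import all_classical all_reals all_analysis.

Set Implicit Arguments.
Unset Strict Implicit.
Unset Printing Implicit Defensive.

Import Order.TTheory GRing.Theory Num.Theory.
Import numFieldNormedType.Exports.

Local Open Scope classical_set_scope.
Local Open Scope ring_scope.

(** * Inner product identities and the Cauchy-Schwarz inequality *)

Section InnerProduct.
Context {R : realType} {X : hilbertType R}.
Implicit Types (x y z : X) (a : R).

Lemma hdotC x y : '[x, y] = '[y, x].
Proof. by rewrite (hermC (hdot : {dot X for (@idfun R)})) expr0 mul1r. Qed.

Lemma hdotDr z x y : '[z, x + y] = '[z, x] + '[z, y].
Proof. exact: linearDr. Qed.

Lemma hdotZr z a x : '[z, a *: x] = a * '[z, x].
Proof. exact: linearZr_LR. Qed.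

Lemma hdotDl z x y : '[x + y, z] = '[x, z] + '[y, z].
Proof. exact: linearDl. Qed.

Lemma hdotZl z a x : '[a *: x, z] = a * '[x, z].
Proof. exact: linearZl_LR. Qed.

Lemma hdotNr z x : '[z, - x] = - '[z, x].
Proof. exact: linearNr. Qed.

Lemma hdot_suml z I (s : seq I) (P : pred I) (E : I -> X) :
  '[\sum_(i <- s | P i) E i, z] = \sum_(i <- s | P i) '[E i, z].
Proof. exact: linear_sumlz. Qed.

Lemma hdot_inj x y : (forall h, '[x, h] = '[y, h]) -> x = y.
Proof.
move=> xy; apply/eqP; rewrite -subr_eq0 -normr_eq0 -sqrf_eq0 -hdot_norm.
by rewrite hdotDl -scaleN1r hdotZl xy; apply/eqP; ring.
Qed.

Lemma sqr_normD x y : `|x + y| ^+ 2 = `|x| ^+ 2 + 2 * '[x, y] + `|y| ^+ 2.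
Proof. by rewrite -!hdot_norm hdotDl !hdotDr (hdotC y x); ring. Qed.

Lemma parallelogram x y :
  `|x + y| ^+ 2 + `|x - y| ^+ 2 = 2 * (`|x| ^+ 2 + `|y| ^+ 2).
Proof. by rewrite !sqr_normD hdotNr normrN; ring. Qed.

Lemma Cauchy_Schwarz x y : `|'[x, y]| <= `|x| * `|y|.
Proof.
have [->|y0] := eqVneq y 0.
  by rewrite -(scale0r (0 : X)) hdotZr mul0r normr0 mulr_ge0.
rewrite -ler_sqr ?nnegrE ?mulr_ge0// real_normK ?num_real// exprMn.
have y2 : 0 < `|y| ^+ 2 by rewrite exprn_gt0 ?normr_gt0.
(* This vector is [|y|^2] times the component of [x] orthogonal to [y]. *)
have := sqr_ge0 (`| (`|y| ^+ 2 *: x + (- (hdot x y)) *: y) |).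
rewrite sqr_normD !normrZ hdotZl hdotZr !exprMn !real_normK ?num_real//.
rewrite (_ : _ + _ = `|y| ^+ 2 * (`|x| ^+ 2 * `|y| ^+ 2 - '[x, y] ^+ 2)).
  by rewrite pmulr_rge0// subr_ge0.
by ring.
Qed.

End InnerProduct.

(** * Riesz representation *)

Lemma hdotl_continuous (R : realType) (X : hilbertType R) (h : X) :
  continuous (fun x : X => '[x, h] : R^o).
Proof.
have lin : linear (fun x : X => '[x, h] : R^o).
  by move=> a u v; rewrite hdotDl hdotZl.
pose lM := GRing.isLinear.Build _ _ _ _ _ lin.
pose L : {linear X -> R^o} := HB.pack (fun x : X => '[x, h] : R^o) lM.
apply: (@bounded_linear_continuous _ _ _ L); apply/linear_boundedP.
near=> r => x; apply: (le_trans (Cauchy_Schwarz _ _)); rewrite mulrC.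
by rewrite ler_wpM2r//; near: r; exact: nbhs_pinfty_ge.
Unshelve. all: by end_near. Qed.

(** The choice [t = - d / (N + 1)] turns the expression into [- (d / (N + 1))^2]; the [+ 1] covers
    [N = 0]. *)
Lemma eq0_of_quadratic_ge0 (R : realType) (d N : R) :
  0 <= N -> (forall t, 0 <= t * d + t ^+ 2 * N) -> d = 0.
Proof.
move=> N0 /(_ (- d / (N + 1))); have N1 : 0 < N + 1 by lra.
rewrite (_ : _ + _ = - (d / (N + 1)) ^+ 2); last by field; lra.
rewrite oppr_ge0 => d0; have /eqP : (d / (N + 1)) ^+ 2 = 0.
  by apply/eqP; rewrite eq_le d0 sqr_ge0.
by rewrite sqrf_eq0 mulf_eq0 invr_eq0 (gt_eqF N1) orbF => /eqP.
Qed.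

(* The representative is the minimiser of [J x = |x|^2 - 2 l x]: the
   parallelogram law makes minimising sequences Cauchy. *)
Lemma Riesz (R : realType) (X : hilbertType R) (l : {linear X -> R^o}) :
  continuous l -> exists v : X, forall h, '[v, h] = l h.
Proof.
move=> /linear_lipschitz[k k0 lk].
pose l' : X -> R := l.
have l'Z a x : l' (a *: x) = a * l' x by rewrite /l' linearZ.
have l'D x y : l' (x + y) = l' x + l' y by rewrite /l' linearD.
pose J (x : X) : R := `|x| ^+ 2 - 2 * l' x.
have Jge x : - k ^+ 2 <= J x.
  have := le_trans (ler_norm _) (lk x); have := sqr_ge0 (`|x| - k).
  by rewrite /J; nra.
have infJ : has_inf (range J).
  by split; [exists (J 0), 0|exists (- k ^+ 2) => _ [x _ <-]].
pose I := inf (range J).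
have JI x : I <= J x by apply: ge_inf; [exact: infJ.2|exists x].
have /choice[u uJ] n : exists x, J x < I + n.+1%:R^-1.
  have [|_ [x _ <-] xJ] := @inf_adherent _ (range J) n.+1%:R^-1 _ infJ.
    by rewrite invr_gt0.
  by exists x.
(* By the parallelogram law [|u n - u p|^2 = 2 J (u n) + 2 J (u p) - 4 J z] for the midpoint [z],
   and [J z >= I]. *)
have dist n p : `|u n - u p| ^+ 2 <= 2 * (n.+1%:R^-1 + p.+1%:R^-1).
  have := parallelogram (u n) (u p); have := JI (2^-1 *: (u n + u p)).
  rewrite {1}/J normrZ l'Z l'D exprMn ger0_norm ?invr_ge0//.
  have := uJ n; have := uJ p; rewrite /J (expr2 2^-1).
  by move: n.+1%:R^-1 p.+1%:R^-1 => a b; lra.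
have : cauchy (u @ \oo).
  apply/cauchy_exP => e e0.
  (* From [N] on, both reciprocals in [dist] are below [e^2 / 4]. *)
  pose N := Num.truncn (4 / e ^+ 2); exists (u N).
  suff : \forall n \near \oo, ball (u N) e (u n) by [].
  near=> n; rewrite -ball_normE /=.
  rewrite -ltr_sqr ?nnegrE ?(ltW e0)//. apply: (le_lt_trans (dist _ _)).
  have Nn : n.+1%:R^-1 <= N.+1%:R^-1 :> R.
    by rewrite lef_pV2 ?posrE// ler_nat ltnS; near: n; exact: nbhs_infty_ge.
  have : N.+1%:R^-1 < e ^+ 2 / 4.
    rewrite -[ltRHS]invrK invf_div.
    by rewrite ltf_pV2 ?posrE ?divr_gt0 ?exprn_gt0 ?truncnS_gt.
  by move: Nn; move: n.+1%:R^-1 N.+1%:R^-1 => a b; lra.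
move=> /cauchy_cvgP/cvg_ex[v uv].
exists v => h; rewrite -[l h]/(l' h); apply/eqP; rewrite -subr_eq0; apply/eqP.
(* This is [J (v + t h) >= J v] expanded in [t]. It holds at [u n] up to the error [1 / (n + 1)], so
   only ['[u n, h]] has to pass to the limit; the [+ 0] added below is the limit of that error. *)
suff key t : 0 <= t * (2 * ('[v, h] - l' h)) + t ^+ 2 * `|h| ^+ 2.
  by have := eq0_of_quadratic_ge0 (sqr_ge0 `|h|) key; lra.
have -> : t * (2 * ('[v, h] - l' h)) + t ^+ 2 * `|h| ^+ 2
    = 2 * t * '[v, h] + (t ^+ 2 * `|h| ^+ 2 - 2 * t * l' h) + 0 by ring.
have uh : '[u n, h] @[n --> \oo] --> '[v, h].
  exact: (cvg_comp _ _ uv (@hdotl_continuous _ _ h v)).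
have lim : 2 * t * '[u n, h] + (t ^+ 2 * `|h| ^+ 2 - 2 * t * l' h) + n.+1%:R^-1
    @[n --> \oo] --> 2 * t * '[v, h] + (t ^+ 2 * `|h| ^+ 2 - 2 * t * l' h) + 0.
  apply: cvgD; last exact: cvg_harmonic.
  by apply: cvgD; [exact: cvgMr|exact: cvg_cst].
apply: (cvgr_to_ge lim).
near=> n; have := JI (u n + t *: h); have := uJ n.
rewrite /J sqr_normD l'D l'Z hdotZr normrZ exprMn real_normK ?num_real//.
by move: n.+1%:R^-1 => a; lra.
Unshelve. all: by end_near. Qed.

(** * Gradients and adjoints as Riesz representatives *)

Section Gradients.
Context {R : realType}.

(** [Riesz] makes the set in the definition of [grad] nonempty, so [get] returns an element of it
    and not a default value. *)
Lemma gradP (X : hilbertType R) (f : X -> R^o) x : differentiable f x ->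
  forall h, '[grad f x, h] = 'd f x h.
Proof. by move=> df; have /getPex := Riesz (diff_continuous df). Qed.

Lemma gradE (X : hilbertType R) (f : X -> R^o) x v : differentiable f x ->
  (forall h, '[v, h] = 'd f x h) -> grad f x = v.
Proof. by move=> df vh; apply: hdot_inj => h; rewrite gradP// vh. Qed.

Lemma adjointP (X H : hilbertType R) (A : {linear X -> H}) l :
  continuous A -> forall h, '[adjoint A l, h] = '[l, A h].
Proof.
move=> cA.
have lin : linear (fun h => '[l, A h] : R^o).
  by move=> a u v; rewrite linearP hdotDr hdotZr.
pose lM := GRing.isLinear.Build _ _ _ _ _ lin.
pose L : {linear X -> R^o} := HB.pack (fun h => '[l, A h] : R^o) lM.
suff /Riesz/getPex : continuous L by [].
move=> h.
rewrite /= (_ : (fun _ => _) = (fun y => '[y, l] : R^o) \o A).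
  by apply: continuous_comp; [exact: cA|exact: hdotl_continuous].
by apply/funext => y /=; rewrite hdotC.
Qed.

Lemma is_diff_hdot (X H : hilbertType R) (l : H) (F : X -> H) x :
  differentiable F x ->
  is_diff x (fun y => '[l, F y] : R^o) (fun h => '[l, 'd F x h]).
Proof.
move=> dF.
have lin : linear (fun y : H => '[l, y] : R^o).
  by move=> a u v; rewrite hdotDr hdotZr.
pose lM := GRing.isLinear.Build _ _ _ _ _ lin.
pose L : {linear H -> R^o} := HB.pack (fun y : H => '[l, y] : R^o) lM.
have cL : continuous L.
  rewrite (_ : (L : H -> R^o) = (fun y => '[y, l] : R^o)).
    exact: hdotl_continuous.
  by apply/funext => y /=; rewrite hdotC.
have dL : is_diff (F x) L L.
  by apply: DiffDef; [exact: linear_differentiable|exact: diff_lin].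
exact: (@is_diff_comp _ _ _ _ F ('d F x) L L x (differentiableP dF) dL).
Qed.

Lemma is_diff_edot (X : hilbertType R) m (g : 'I_m -> X -> R^o) mu x :
  (forall i, differentiable (g i) x) ->
  is_diff x (fun y => edot mu (gvec g y) : R^o)
            (fun h => \sum_i mu 0 i * 'd (g i) x h).
Proof.
move=> dg.
rewrite (_ : (fun y => _) = \sum_i mu 0 i *: g i); last first.
  apply/funext => y; rewrite fct_sumE; apply: eq_bigr => i _.
  by rewrite mxE.
rewrite (_ : (fun h => _) = \sum_i (mu 0 i *: ('d (g i) x : X -> R^o))).
  (* One joint induction builds the function and its differential summand by summand. *)
  elim/big_rec2 : _ => [|i f1 f2 _ IH]; first exact: is_diff_cst.
  by apply: is_diffD; apply: is_diffZ; exact: differentiableP.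
by apply/funext => h; rewrite fct_sumE.
Qed.

(** Splits off the vector [w] of [Qform]. The right side represents the differential of the
    Lagrangian term by term, and a Riesz representative is unique. *)
Lemma grad_lagrangianE (X H : hilbertType R) m (f : X -> R^o) (F : X -> H)
    (g : 'I_m -> X -> R^o) x lambda mu :
  differentiable f x -> differentiable F x ->
  (forall i, differentiable (g i) x) ->
  grad_lagrangian f F g x lambda mu =
  grad f x + (adjoint ('d F x) lambda + \sum_i mu 0 i *: grad (g i) x).
Proof.
move=> df dF dg.
have dL := is_diffD (is_diffD (differentiableP df) (is_diff_hdot lambda dF))
                    (is_diff_edot mu dg).
apply: gradE; first exact: ex_diff.
move=> h; rewrite (_ : 'd _ x h = ('d f x h + '[lambda, 'd F x h])
                       + \sum_i mu 0 i * 'd (g i) x h); last first.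
  by rewrite (@diff_val _ _ _ _ _ _ _ dL).
rewrite !hdotDl gradP// adjointP; last exact: diff_continuous.
rewrite hdot_suml addrA; congr (_ + _); apply: eq_bigr => i _.
by rewrite hdotZl gradP.
Qed.

End Gradients.

(** * Euclidean norm by coordinates *)

Section Euclidean.
Context {R : realType} {m : nat}.
Implicit Types y mu : 'rV[R]_m.

Lemma enorm_sqr y : enorm y ^+ 2 = \sum_i y 0 i ^+ 2.
Proof. by rewrite sqr_sqrtr ?sumr_ge0// => i _; rewrite -expr2 sqr_ge0. Qed.

Lemma sqr_coord_le y i : y 0 i ^+ 2 <= enorm y ^+ 2.
Proof.
rewrite enorm_sqr (bigD1 i)//= lerDl sumr_ge0// => j _; exact: sqr_ge0.
Qed.

End Euclidean.

(** * Comparison of [Qform] with [eta] *)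

Section Coercivity.
Context {R : realType} {X H : hilbertType R} {m : nat}.
Variables (f : X -> R^o) (F : X -> H) (g : 'I_m -> X -> R^o).

Lemma eta_ge0 x lambda mu : 0 <= Defs.eta f F g x lambda mu.
Proof.
rewrite addr_ge0// mulr_ge0 ?invr_ge0 ?sqr_ge0//.
by rewrite sumr_ge0// => i _; exact: sqr_ge0.
Qed.

(* [eta] is [Qform] with the gradient of [f] added to the vector [w], so the
   inequality [|u|^2 <= 2 |u + v|^2 + 2 |v|^2] compares them. *)
Lemma Qform_le_eta x lambda mu :
  differentiable f x -> differentiable F x ->
  (forall i, differentiable (g i) x) ->
  Qform F g x lambda mu <= 2 * Defs.eta f F g x lambda mu
    + `|'d F x (grad f x)| ^+ 2 + \sum_i '[grad (g i) x, grad f x] ^+ 2.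
Proof.
move=> df dF dg; rewrite /Defs.eta grad_lagrangianE// /Qform.
set w := adjoint _ _ + _; set v := grad f x.
rewrite enorm_sqr (linearD _ v).
have dFw : `|'d F x w| ^+ 2 <=
    2 * `|'d F x v + 'd F x w| ^+ 2 + 2 * `|'d F x v| ^+ 2.
  (* The slack is a square: [2 |v + w|^2 + 2 |v|^2 - |w|^2 = |w + 2 v|^2], applied to the images
     under ['d F x], and below to each coordinate. *)
  have := sqr_ge0 `|'d F x w + 2 *: 'd F x v|.
  rewrite !sqr_normD normrZ exprMn real_normK ?num_real// hdotZr.
  by rewrite (hdotC ('d F x v)); nra.
have dgw : \sum_i (grad_g_mul g x w
      + mu *m diag_mx (\row_i g i x ^+ 2)) 0 i ^+ 2 <=
    2 * (\sum_i ('[grad (g i) x, v + w] + g i x ^+ 2 * mu 0 i) ^+ 2)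
    + 2 * \sum_i '[grad (g i) x, v] ^+ 2.
  rewrite !mulr_sumr -big_split/=; apply: ler_sum => i _.
  rewrite mul_mx_diag !mxE hdotDr.
  move: '[_, v] '[_, w] (g i x) (mu 0 i) => p q s t.
  by have := sqr_ge0 (q + s ^+ 2 * t + 2 * p); nra.
move: dFw dgw; lra.
Qed.

End Coercivity.

(** * Lower bounds for the multiplier and penalty terms *)

Section LowerBounds.
Context {R : realType}.

(* Completing the square in [l y]. *)
Lemma multiplier_term_ge (c phi0 l y t d : R) : 0 < c -> 0 < phi0 ->
  phi0 * y ^+ 2 <= t -> - (l * y) <= d ->
  c * phi0 / 2 * y ^+ 2 - (2 * phi0)^-1 / c <=
  d + c / 2 * (1 + l ^+ 2) * t.
Proof.
move=> c0 p0 yt ld.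
have h1 : c / 2 * (1 + l ^+ 2) * (phi0 * y ^+ 2) <= c / 2 * (1 + l ^+ 2) * t.
  by rewrite ler_wpM2l// mulr_ge0 ?divr_ge0 ?addr_ge0 ?sqr_ge0 ?(ltW c0).
(* The share [l^2] of the weight [1 + l^2] absorbs the linear term at the cost [(2 * phi0)^-1 / c];
   the share [1] survives as the penalty on [y]. *)
have h2 : 0 <= c * phi0 / 2 * (l * y - (c * phi0)^-1) ^+ 2.
  by rewrite mulr_ge0 ?sqr_ge0// divr_ge0// mulr_ge0 ?ltW.
have e2 : c * phi0 / 2 * (l * y - (c * phi0)^-1) ^+ 2
    = c / 2 * l ^+ 2 * (phi0 * y ^+ 2) - l * y + (2 * phi0)^-1 / c.
  by field; lra.
by rewrite e2 in h2; lra.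
Qed.

(* Half of the quadratic term is spent on completing the square in [mu]. *)
Lemma penalty_term_ge (c p P g mu q : R) : 0 < c -> 0 < p -> p <= P ->
  q = Num.max g (- (c^-1 * p * mu)) ->
  c / (4 * P) * Num.max g 0 ^+ 2 - c^-1 * (p * mu ^+ 2) <=
  mu * q + c / (2 * p) * q ^+ 2.
Proof.
move=> c0 p0 pP qE.
have h1 : 0 <= c / (4 * p) * (q + 2 * p * mu / c) ^+ 2.
  by rewrite mulr_ge0 ?sqr_ge0// divr_ge0 ?mulr_ge0 ?ltW.
have e1 : c / (4 * p) * (q + 2 * p * mu / c) ^+ 2 =
    mu * q + c / (2 * p) * q ^+ 2 - c / (4 * p) * q ^+ 2 + c^-1 * (p * mu ^+ 2).
  by field; lra.
(* Where [g > 0], the maximum [q] is at least [g]; elsewhere the left side vanishes. *)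
have h2 : c / (4 * P) * Num.max g 0 ^+ 2 <= c / (4 * p) * q ^+ 2.
  apply: ler_pM; rewrite ?sqr_ge0 ?divr_ge0 ?mulr_ge0 ?(ltW c0)//; [lra| |].
    by rewrite ler_pM2l// lef_pV2 ?posrE; lra.
  have [g0|g0] := leP g 0; first by rewrite expr0n sqr_ge0.
  rewrite ler_pXn2r ?nnegrE ?(ltW g0)// qE ?le_max ?lexx ?(ltW g0)//.
by move: h1; rewrite e1; lra.
Qed.

(** The factor [1 + |mu|^2] in the denominator of [p] gives [p |mu|^2 <= b <= P], so the
    coordinatewise errors add up to at most [P / c], uniformly in [mu]. *)
Lemma penalty_ge m (c b P p : R) (y mu q : 'rV[R]_m) :
  0 < c -> 0 < b -> b <= P -> p = b / (1 + enorm mu ^+ 2) ->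
  q = vmax y (- ((c^-1 * p) *: mu)) ->
  c / (4 * P) * enorm (vmax y 0) ^+ 2 - P / c <=
  edot mu q + c / (2 * p) * enorm q ^+ 2.
Proof.
move=> c0 b0 bP pE qE.
have n0 : 0 <= enorm mu ^+ 2 by exact: sqr_ge0.
have p0 : 0 < p by rewrite pE divr_gt0// ltr_pwDl.
have pb : p <= b.
  by rewrite pE ler_pdivrMr ?ltr_pwDl// ler_peMr ?(ltW b0)// lerDl.
have pn : p * enorm mu ^+ 2 <= P.
  apply: le_trans bP; rewrite pE mulrAC ler_pdivrMr ?ltr_pwDl//.
  by rewrite ler_wpM2l ?(ltW b0)// lerDr.
apply: (@le_trans _ _ (c / (4 * P) * enorm (vmax y 0) ^+ 2
                      - c^-1 * (p * enorm mu ^+ 2))).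
  by rewrite lerD2l lerN2 mulrC ler_wpM2r ?invr_ge0 ?(ltW c0).
rewrite !enorm_sqr !mulr_sumr -sumrB -big_split/=; apply: ler_sum => i _.
by rewrite qE !mxE; apply: penalty_term_ge => //; exact: le_trans bP.
Qed.

End LowerBounds.

(** * Estimate on the sublevel set *)

Section Sublevel.
Context {R : realType} {X H : hilbertType R} {m : nat}.
Variables (f : X -> R^o) (F : X -> H) (g : 'I_m -> X -> R^o).
Variables (phi : R -> \bar R) (psi : 'rV[R]_m -> R).

Lemma sublevel_Omega x lambda mu c gamma :
  sublevel f F g phi psi c gamma (x, lambda, mu) -> Omega F g phi psi x.
Proof.
by rewrite /sublevel /aug_lagrangian /=; case: ifPn => [/set_mem|].
Qed.

(** Adds the two lower bounds, with [P = psi 0] since [psi] is maximal at [0]. The error depends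
    neither on [x] nor on the multipliers. *)
Lemma sublevel_le (phi0 : R) x lambda mu c gamma :
  0 < phi0 -> (forall t, 0 <= t -> ((phi0 * t)%:E <= phi t)%E) ->
  (forall y, orthant y -> psi y <= psi 0) -> 0 < c ->
  sublevel f F g phi psi c gamma (x, lambda, mu) ->
  f x + c * phi0 / 2 * `|F x| ^+ 2
    + c / (4 * psi 0) * enorm (vmax (gvec g x) 0) ^+ 2
    + Defs.eta f F g x lambda mu <= gamma + ((2 * phi0)^-1 + psi 0) / c.
Proof.
move=> p0 phi_ge psi_le c0 Sx; have Ox := sublevel_Omega Sx.
have [b0 phi_fin] := Ox.
have bP : bfun g psi x <= psi 0.
  by apply: psi_le => i; rewrite !mxE le_max lexx orbT.
have := phi_ge _ (sqr_ge0 `|F x|).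
move: Sx; rewrite /sublevel /aug_lagrangian /= (mem_set Ox).
(* Membership in [Omega] excludes [+oo], and the linear minorant excludes [-oo]. *)
move: phi_fin; case: (phi _) => [t|//|//] _.
rewrite -EFinM -!EFinD !lee_fin => Sx pt.
have ld : - (`|lambda| * `|F x|) <= '[lambda, F x].
  by have := Cauchy_Schwarz lambda (F x); rewrite ler_norml => /andP[].
have h1 := multiplier_term_ge c0 p0 pt ld.
have h2 := penalty_ge (y := gvec g x) (mu := mu) c0 b0 bP erefl erefl.
move: Sx h1 h2; rewrite /aug_q /pfun [_ / c in X in _ -> _ -> _ -> X]mulrDl.
lra.
Qed.

End Sublevel.

(** * From coercivity to boundedness *)

Lemma le_of_sqr_le (R : realType) (y b : R) : y ^+ 2 <= b -> y <= 1 + b.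
Proof. by have := sqr_ge0 (y - 1); nra. Qed.

Lemma norm_rV_le (R : realType) m (y : 'rV[R]_m) (b : R) :
  0 <= b -> (forall i, `|y 0 i| <= b) -> `|y| <= b.
Proof.
move=> b0 yb; have [y0|/mx_norm_neq0[[i j] yE]] := eqVneq (mx_norm y) 0.
  by rewrite /Num.norm/= y0.
by rewrite /Num.norm/= yE /= ord1.
Qed.

Lemma bounded_ex (R : realType) (T : Type) (V : normedModType R) (A : set T)
    (h : T -> V) : [bounded h x | x in A] ->
  exists2 K : R, 0 <= K & forall x, A x -> `|h x| <= K.
Proof. by move=> /pinfty_ex_gt0[K K0 hK]; exists K; [exact: ltW|exact: hK]. Qed.

Theorem theorem3p5 (R : realType) (X H : hilbertType R) (m : nat)
    (f : X -> R^o) (F : X -> H) (g : 'I_m -> X -> R^o)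
    (phi : R -> \bar R) (psi : 'rV[R]_m -> R) (gamma : R)
    (f_C1 : C1 f) (F_C1 : C1 F) (g_C1 : forall i, C1 (g i))
    (has_optimum : exists x, globally_optimal f F g x)
    (phi_adm : phi_admissible phi) (psi_adm : psi_admissible psi)
    (phi_linear : exists2 phi0 : R, 0 < phi0 &
       forall t, 0 <= t -> ((phi0 * t)%:E <= phi t)%E)
    (r eps : R) (r_gt0 : 0 < r) (eps_gt0 : 0 < eps)
    (Omega_bounded :
       bounded_set (Omega_sub f F g phi psi r (gamma + eps)))
    (f_bounded_below : exists K : R,
       forall x, Omega_sub f F g phi psi r (gamma + eps) x -> K <= f x)
    (g_bounded :
       [bounded gvec g x | x in Omega_sub f F g phi psi r (gamma + eps)])
    (grad_f_bounded :
       [bounded grad f x | x in Omega_sub f F g phi psi r (gamma + eps)])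
    (grad_g_bounded : forall i,
       [bounded grad (g i) x | x in Omega_sub f F g phi psi r (gamma + eps)])
    (DF_bounded :
       op_bounded_on (Omega_sub f F g phi psi r (gamma + eps))
                     (fun x => 'd F x))
    (Q_coercive : exists2 a : R, 0 < a &
       forall x, Omega_sub f F g phi psi r (gamma + eps) x ->
       forall (lambda : H) (mu : 'rV[R]_m),
         a * (`|lambda| ^+ 2 + enorm mu ^+ 2) <= Qform F g x lambda mu) :
  exists2 c0 : R, 0 < c0 &
    forall c, c0 <= c -> bounded_set (sublevel f F g phi psi c gamma).
Proof.
have [phi0 p0 phi_ge] := phi_linear.
have P0 := psi0_gt0 psi_adm; have psi_le := psi0_max psi_adm.
set D := Omega_sub _ _ _ _ _ _ _ in Omega_bounded f_bounded_below g_bounded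
  grad_f_bounded grad_g_bounded DF_bounded Q_coercive.
have [BX BX0 XD] := bounded_ex Omega_bounded.
have [K fK] := f_bounded_below.
have [Gf Gf0 gradfD] := bounded_ex grad_f_bounded.
have [Gg gradgD] : exists G : 'I_m -> R,
    forall i x, D x -> `|grad (g i) x| <= G i.
  have /choice[G GD] i : exists K, forall x, D x -> `|grad (g i) x| <= K.
    by have [L _ LD] := bounded_ex (grad_g_bounded i); exists L.
  by exists G.
have [L DFL] := DF_bounded.
have [a a0 Qa] := Q_coercive.
pose A := (2 * phi0)^-1 + psi 0.
have A0 : 0 < A by rewrite addr_gt0// invr_gt0 mulr_gt0.
(* The three summands ensure, in order, [rc1], [rc2] and [Ac]. *)
pose c0 := 2 * r / phi0 + 4 * psi 0 * r + A / eps.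
have [c1 c2 c3] : [/\ 0 < 2 * r / phi0, 0 < 4 * psi 0 * r & 0 < A / eps].
  by split; rewrite ?divr_gt0 ?mulr_gt0.
exists c0 => [|c cc0]; first by rewrite !addr_gt0.
have c_gt0 : 0 < c by apply: lt_le_trans cc0; rewrite !addr_gt0.
have rc1 : r <= c * phi0 / 2.
  have : 2 * r / phi0 <= c by rewrite /c0 in cc0; lra.
  by rewrite ler_pdivrMr//; lra.
have rc2 : r <= c / (4 * psi 0).
  by rewrite ler_pdivlMr ?mulr_gt0//; rewrite /c0 in cc0; lra.
have Ac : A / c <= eps.
  have : A / eps <= c by rewrite /c0 in cc0; lra.
  by rewrite !ler_pdivrMr// mulrC.
(* The first term bounds [2 * eta], as [f >= K] on [D]; the others bound the terms with [grad f x]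
   in [Qform_le_eta]. *)
pose C := 2 * (gamma + eps - K) + (L * Gf) ^+ 2 + \sum_i (Gg i * Gf) ^+ 2.
have main x lambda mu : sublevel f F g phi psi c gamma (x, lambda, mu) ->
    D x /\ a * (`|lambda| ^+ 2 + enorm mu ^+ 2) <= C.
  move=> Sx; have := sublevel_le p0 phi_ge psi_le c_gt0 Sx.
  rewrite -/A; have e0 := eta_ge0 f F g x lambda mu.
  have := ler_wpM2r (sqr_ge0 `|F x|) rc1.
  have := ler_wpM2r (sqr_ge0 (enorm (vmax (gvec g x) 0))) rc2.
  have := mulr_ge0 (ltW r_gt0) (sqr_ge0 `|F x|).
  have := mulr_ge0 (ltW r_gt0) (sqr_ge0 (enorm (vmax (gvec g x) 0))).
  move=> h1 h2 h3 h4 h5.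
  (* By [rc1] and [rc2] the penalty with weight [r] is no larger than the one just estimated, and by
     [Ac] the error fits into [eps]. *)
  have Dx : D x by split; [exact: sublevel_Omega Sx|lra].
  split=> //; apply: (le_trans (Qa x Dx lambda mu)).
  apply: (le_trans (Qform_le_eta lambda mu (f_C1.1 x) (F_C1.1 x)
                      (fun i => (g_C1 i).1 x))).
  apply: lerD; first apply: lerD.
  - by have := fK x Dx; lra.
  (* [L] carries no sign, hence the absolute value; squaring removes it. *)
  - have LL : `|'d F x (grad f x)| <= `|L| * Gf.
      apply: (le_trans (DFL x Dx _)).
      apply: (@le_trans _ _ (`|L| * `|grad f x|)).
        by rewrite ler_wpM2r// ler_norm.
      by rewrite ler_wpM2l//; exact: gradfD.
    rewrite -(real_normK (num_real (L * Gf))) normrM (ger0_norm Gf0).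
    by rewrite ler_pXn2r ?nnegrE// mulr_ge0.
  - apply: ler_sum => i _; rewrite -(real_normK (num_real '[_, _])).
    have Gx : `|'[grad (g i) x, grad f x]| <= Gg i * Gf.
      by apply: (le_trans (Cauchy_Schwarz _ _)); apply: ler_pM; auto.
    by rewrite ler_pXn2r ?nnegrE// (le_trans _ Gx).
(* [y <= 1 + y^2] avoids a square root, and the absolute value keeps the bound nonnegative whatever
   the sign of [C]. *)
have sqr_bound (y : R) : a * y ^+ 2 <= C -> y <= 1 + `|C / a|.
  move=> yC; apply: le_of_sqr_le; apply: le_trans (ler_norm _).
  by rewrite ler_pdivlMr// mulrC.
rewrite /= /bounded_near; near=> N => -[[x lambda] mu] /main[/XD xB lmC].
have NB : BX + (1 + `|C / a|) <= N.
  by near: N; apply: nbhs_pinfty_ge; exact: num_real.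
(* The product norm is the maximum of the three component norms, so the sum in [NB] dominates each
   bound; [mu] is treated entrywise because its norm is the sup norm. *)
rewrite /= !prod_normE /= !ge_max; apply/andP; split; first (apply/andP; split).
- by apply: le_trans xB _; apply: le_trans NB; rewrite lerDl.
- apply: le_trans NB; apply: ler_wpDl => //; apply: sqr_bound.
  apply: le_trans lmC.
  by rewrite ler_pM2l// lerDl sqr_ge0.
- apply: le_trans NB; apply: ler_wpDl => //; apply: norm_rV_le => // i.
  apply: sqr_bound; apply: le_trans lmC; rewrite real_normK ?num_real//.
  by rewrite ler_pM2l// (le_trans (sqr_coord_le mu i))// lerDr sqr_ge0.
Unshelve. all: by end_near. Qed.
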